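(* For any graph $H$ of order at least $2$, $\operatorname{adim}_2(K_1+H)\le\operatorname{adim}_2(H)+2$.
   Context: All graphs are finite and simple. The join $K_1+H$ is obtained from $H$ by adding a new vertex adjacent to all vertices of $H$. For a graph $G=(V,E)$, $d_{G,2}(x,y)=\min\{d_G(x,y),2\}$ with $d_G$ the shortest-path distance ($\infty$ between different components). For distinct $x,y$, $\mathcal{C}_G(x,y)=\{z\in V: d_{G,2}(x,z)\ne d_{G,2}(y,z)\}$. A set $S\subseteq V$ is a $2$-adjacency generator if $|S\cap\mathcal{C}_G(x,y)|\ge 2$ for all distinct $x,y$; $\operatorname{adim}_2(G)$ is the minimum cardinality of such a set. *)

(* Defs.v *)
From mathcomp Require Import all_boot.

Set Implicit Arguments.
Unset Strict Implicit.
Unset Printing Implicit Defensive.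

Record sgraph := SGraph {
  vertex :> finType;
  adj : rel vertex;
  adj_sym : symmetric adj;
  adj_irrefl : irreflexive adj
}.

Section Distance.
Variable G : sgraph.
Implicit Types (x y z : G) (S : {set G}).

Definition has_walk x y (n : nat) : bool :=
  [exists p : n.-tuple G, path (@adj G) x p && (last x p == y)].

Lemma connect_has_walk x y : connect (@adj G) x y -> exists n, has_walk x y n.
Proof.
move=> /connectP [p pP ->]; exists (size p).
by apply/existsP; exists (in_tuple p); rewrite pP eqxx.
Qed.

(* The shortest-path distance; [None] stands for infinity. *)
Definition dist x y : option nat :=
  if @idP (connect (@adj G) x y) is ReflectT c
  then Some (ex_minn (connect_has_walk c)) else None.

Definition dist2 x y : nat := if dist x y is Some n then minn n 2 else 2.

Definition distinguishers x y : {set G} :=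
  [set z | dist2 x z != dist2 y z].

Definition adj2_generator S : bool :=
  [forall x, forall y, (x != y) ==> (2 <= #|S :&: distinguishers x y|)].

Lemma dist2_eq0 x y : (dist2 x y == 0) = (x == y).
Proof.
rewrite /dist2 /dist; case: {-}_ / idP => [c | nc]; last first.
  by apply/esym/negP => /eqP xy; apply: nc; rewrite xy connect0.
case: ex_minnP => n /existsP [p /andP [pP /eqP pl]] n_min.
have -> : (minn n 2 == 0) = (n == 0) by case: (n) => [|[|m]].
apply/eqP/eqP => [n0 | xy].
  by move: p pP pl; rewrite n0 => p; rewrite tuple0.
apply/eqP; rewrite -leqn0; apply: n_min.
by apply/existsP; exists [tuple]; rewrite /= xy.
Qed.

Lemma adj2_generator_setT : adj2_generator setT.
Proof.
apply/forallP => x; apply/forallP => y; apply/implyP => xy.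
have <- : #|[set x; y]| = 2 by rewrite cards2 xy.
rewrite setTI; apply/subset_leq_card/subsetP => z; rewrite !inE.
have d0 u : dist2 u u = 0 by apply/eqP; rewrite dist2_eq0.
case/orP => /eqP ->; rewrite d0; last by rewrite dist2_eq0.
by rewrite eq_sym dist2_eq0 eq_sym.
Qed.

Lemma ex_adj2_generator :
  exists n, [exists S : {set G}, adj2_generator S && (#|S| == n)].
Proof.
exists #|[set: G]|; apply/existsP; exists setT.
by rewrite adj2_generator_setT eqxx.
Qed.

Definition adim2 : nat := ex_minn ex_adj2_generator.

End Distance.

Section JoinK1.
Variable H : sgraph.

(* [None] is the added vertex. *)
Definition joinK1_adj : rel (option H) := fun u v =>
  match u, v with
  | Some x, Some y => adj x y
  | None, None => false
  | _, _ => true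
  end.

Lemma joinK1_adj_sym : symmetric joinK1_adj.
Proof. by move=> [x|] [y|] //=; apply: adj_sym. Qed.

Lemma joinK1_adj_irrefl : irreflexive joinK1_adj.
Proof. by move=> [x|] //=; apply: adj_irrefl. Qed.

Definition joinK1 : sgraph := SGraph joinK1_adj_sym joinK1_adj_irrefl.

End JoinK1.

(* Main.v *)
(** Let [S] be a minimum 2-adjacency generator of [H]. Two distinct vertices
    adjacent to all of [S] would not be distinguished by [S], so at most one
    vertex [y0] of [H] is adjacent to all of [S]. Adding [y0] and the cone
    vertex to [S] gives a 2-adjacency generator of the join: pairs of [H] are
    distinguished by [S] as before, while the cone vertex is distinguished from
    [y] by itself and by any element of [S] or [y0] not adjacent to [y]. *)
Require Import Defs.
From mathcomp Require Import all_boot.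

(** Truncation at 2 leaves only equality and adjacency visible, so walks can be forgotten from here
    on. *)
Lemma dist2E (G : sgraph) (x y : G) :
  dist2 x y = if x == y then 0 else if adj x y then 1 else 2.
Proof.
case: eqP => [->|/eqP xy]; first by apply/eqP; rewrite dist2_eq0.
have : dist2 x y != 0 by rewrite dist2_eq0.
have has_walk1 : has_walk x y 1 = adj x y.
  apply/existsP/idP => [[p]|xyE].
    by case/tupleP: p => z p; rewrite tuple0 /= andbT => /andP[xz /eqP <-].
  by exists [tuple y]; rewrite /= xyE eqxx.
rewrite /dist2 /dist; case: {-}_ / idP => [c|nc]; last first.
  by case: ifP => // xyE; case: nc; apply: connect1.
case: ex_minnP => n nP n_min n0; case: ifP => [xyE|xyN].
  have := n_min 1; rewrite has_walk1 => /(_ xyE).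
  by case: n n0 {nP n_min} => [|[|n]].
case: n n0 nP {n_min} => [|[|n]] //.
by rewrite has_walk1 xyN.
Qed.

Lemma adim2_le (G : sgraph) (S : {set G}) : adj2_generator S -> adim2 G <= #|S|.
Proof.
rewrite /adim2 => gS; case: ex_minnP => n _; apply.
by apply/existsP; exists S; rewrite gS eqxx.
Qed.

Lemma adim2_attained (G : sgraph) :
  exists2 S : {set G}, adj2_generator S & #|S| = adim2 G.
Proof.
rewrite /adim2; case: ex_minnP => n /existsP[S /andP[gS /eqP cS]] _.
by exists S.
Qed.

(** The cone vertex only shortens distances above 2 to exactly 2, which truncation hides. *)
Lemma dist2_joinK1 (H : sgraph) (x y : H) :
  dist2 (Some x : joinK1 H) (Some y) = dist2 x y.
Proof. by rewrite !dist2E. Qed.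

Lemma adj2_generator_dominator_unique (G : sgraph) (S : {set G}) (x y : G) :
  adj2_generator S -> {in S, forall z, adj x z} -> {in S, forall z, adj y z} ->
  x = y.
Proof.
move=> /forallP/(_ x)/forallP/(_ y)/implyP gS xS yS; apply/eqP.
apply: contraT => /gS; suff -> : S :&: distinguishers x y = set0.
  by rewrite cards0.
apply/setP => z; rewrite !inE; apply/negP => /andP[zS].
(* By irreflexivity neither [x] nor [y] is in [S], so both are at truncated distance exactly 1 from
   [z]. *)
have adj_neq u : adj u z -> (u == z) = false.
  by move=> uz; apply/eqP => uE; rewrite uE adj_irrefl in uz.
by rewrite !dist2E xS ?yS // !adj_neq ?xS ?yS.
Qed.

Lemma adj2_generator_joinK1 (H : sgraph) (S T : {set H}) :
  adj2_generator S -> S \subset T ->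
  (forall y, exists2 z, z \in T & ~~ adj y z) ->
  adj2_generator (None |: Some @: T : {set joinK1 H}).
Proof.
move=> gS /subsetP sST ndom.
have cone (y : H) : 2 <= #|(None |: Some @: T : {set joinK1 H})
    :&: distinguishers (None : joinK1 H) (Some y)|.
  have [z zT yz] := ndom y.
  (* From the cone vertex and from [Some y], [None] is at distances 0 and 1, while [Some z] is at
     distance 1 and at 2, or 0 if [z] is [y]. *)
  have <- : #|[set None; Some z]| = 2 by rewrite cards2.
  apply/subset_leq_card/subsetP => w; rewrite !inE.
  case/orP => /eqP ->; rewrite !dist2E //=.
  by rewrite imset_f //= (negPf yz); case: ifP.
apply/forallP => -[x|]; apply/forallP => -[y|]; apply/implyP => // xy.
- have {}xy : x != y by apply: contraNneq xy => ->.
  move: gS => /forallP/(_ x)/forallP/(_ y)/implyP/(_ xy)/leq_trans; apply.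
  rewrite -(card_imset _ (@Some_inj _)).
  apply/subset_leq_card/subsetP => _ /imsetP[z + ->].
  by rewrite !inE !dist2_joinK1 => /andP[/sST zT ->]; rewrite imset_f.
- suff -> : distinguishers (Some x : joinK1 H) None =
            distinguishers (None : joinK1 H) (Some x) by apply: cone.
  by apply/setP => z; rewrite !inE eq_sym.
Qed.

Theorem theorem38 (H : sgraph) (hH : 2 <= #|H|) :
  adim2 (joinK1 H) <= adim2 H + 2.
Proof.
have [S gS <-] := adim2_attained H.
have [T [sST cT ndom]] : exists T : {set H}, [/\ S \subset T, #|T| <= #|S|.+1
    & forall y, exists2 z, z \in T & ~~ adj y z].
  case: (pickP (fun y => [forall z in S, adj y z])) => [y0 /forall_inP y0S|noS].
    exists (y0 |: S); split; first exact: subsetUr.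
      by rewrite cardsU1 -add1n leq_add2r leq_b1.
    move=> y; have [/forall_inP yS|] := boolP [forall z in S, adj y z].
      (* Here [y] must be [y0], which is its own non-neighbour in the enlarged set. *)
      exists y0; first by rewrite setU11.
      by rewrite (adj2_generator_dominator_unique _ _ _ _ gS yS y0S) adj_irrefl.
    by case/forall_inPn => z zS yz; exists z; rewrite // setU1r.
  exists S; split=> // y.
  by have /negbT/forall_inPn[z zS yz] := noS y; exists z.
apply: leq_trans (adim2_le _ _ (adj2_generator_joinK1 _ _ _ gS sST ndom)) _.
(* One unit of the [+ 2] pays for [None]; the other is the slack in the bound on [T]. *)
rewrite addn2 cardsU1 -[X in _ <= X]add1n leq_add ?leq_b1 //.
by rewrite (card_imset _ (@Some_inj _)).
Qed.
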